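(* For every even positive integer $m$, $\mathsf{s}_{2m}(\mathbb{Z}_2^{2m+1}) = 4m+2$.
   Context: For a positive integer $m$ and a nonnegative integer $d$, $\mathsf{s}_{2m}(\mathbb{Z}_2^d)$ denotes the smallest integer $s$ such that every sequence (repetitions allowed) of length $s$ of elements of the group $\mathbb{Z}_2^d$ has a subsequence of length $2m$ whose elements sum to $0$. *)

(* Defs.v *)
From mathcomp Require Import all_boot all_algebra.

Set Implicit Arguments.
Unset Strict Implicit.
Unset Printing Implicit Defensive.

Import GRing.Theory.
Local Open Scope ring_scope.

Definition has_zero_sum_subseq (k d s : nat) : bool :=
  [forall S : s.-tuple 'rV['F_2]_d,
    [exists T : k.-tuple 'rV['F_2]_d, subseq T S && (\sum_(x <- T) x == 0)]].

(* Pigeonhole: a long enough sequence repeats some element 2m times. *)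
Lemma ex_has_zero_sum_subseq (m d : nat) :
  exists s, has_zero_sum_subseq (2 * m) d s.
Proof.
exists (2 * m * #|{: 'rV['F_2]_d}|)%N; apply/forallP => S.
have [x le_x] : exists x : 'rV['F_2]_d, (2 * m <= count_mem x S)%N.
  apply/existsP; apply: contraT; rewrite negb_exists => /forallP lt_S.
  have sumS : (\sum_(x : 'rV['F_2]_d) count_mem x S
                = 2 * m * #|{: 'rV['F_2]_d}|)%N.
    rewrite -[RHS](size_tuple S); elim: (tval S) => [|y s IHs] /=; first by rewrite big1.
    rewrite big_split /= IHs (bigD1 y) //= eqxx big1 ?addn0 //.
    by move=> z /negPf zy; rewrite eq_sym zy.
  have : (\sum_(x : 'rV['F_2]_d) (count_mem x S).+1
          <= \sum_(x : 'rV['F_2]_d) 2 * m)%N.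
    by apply: leq_sum => x _; rewrite ltnNge.
  under eq_bigr => x _ do rewrite -addn1.
  rewrite big_split /= sumS !sum_nat_const muln1 [X in (_ <= X)%N]mulnC.
  by rewrite -[X in (_ <= X)%N]addn0 leq_add2l leqNgt (cardD1 0).
apply/existsP; exists [tuple of nseq (2 * m) x]; apply/andP; split.
  apply: (@subseq_trans _ (nseq (count_mem x S) x)).
    by rewrite -(subnKC le_x) nseqD prefix_subseq.
  by rewrite -size_filter -(all_pred1P _ _ (filter_all (pred1 x) S)) filter_subseq.
rewrite big_nseq -Monoid.iteropE /= -[iterop _ _ _ _]/(x *+ (2 * m)).
have x2 : x *+ 2 = 0.
  by apply/rowP => i; rewrite !mxE; apply/val_inj; case: (x 0 i) => -[|[|]].
by rewrite mulrnA x2 mul0rn.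
Qed.

(* s_{2m}(Z_2^d): the index is m, not 2m. *)
Definition s_even (m d : nat) : nat := ex_minn (ex_has_zero_sum_subseq m d).

(* Main.v *)
Require Import Defs.
From mathcomp Require Import all_boot all_fingroup all_algebra.

Set Implicit Arguments.
Unset Strict Implicit.
Unset Printing Implicit Defensive.

Import GRing.Theory.

(* Lower bound: the unit vectors of Z_2^(2m+1), their sum and 2m-1 zeros contain no
   zero-sum subsequence of length 2m.

   Upper bound: put r = 2m+1, split a sequence of length 2r into r pairs a_l, b_l
   and let e_l = a_l + b_l, choosing the splitting so that the rank of the e_l is
   maximal. A selection takes both vectors of the pairs in a set D, none of those
   in a set Z with |Z| = |D| + 1, and one vector of each other pair; it has 2m
   elements, and the last choice may be corrected by any combination of the
   corresponding e_l.

   If the e_l are dependent, a functional vanishing on all of them splits the pairs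
   into two classes. By maximality, exchanging vectors between pairs of different
   classes shows that sum_l e_l = 0 is the only relation, and then dropping one pair
   of the right class leaves a solvable system.

   If the e_l form a basis, let x_il be the e_i-coordinate of a_l. The absence of a
   zero-sum selection with |D| = 0, 1, 2 says that the off-diagonal row sums of x
   are odd and that certain patterns on 3 and 5 indices are forbidden. They force
   x_ij + x_ji = 1 + u_i + u_j for some u, so that x_ij + u_i is a tournament with
   odd outdegrees on r vertices. Counting arcs gives r = 3 mod 4, so m is odd. *)

(** * Zero-sum index sets and the lower bound *)

Lemma zero_sum_subseqP k d s (S : s.-tuple 'rV['F_2]_d) :
  reflect (exists2 B : {set 'I_s}, #|B| = k & (\sum_(i in B) tnth S i = 0)%R)
    [exists T : k.-tuple 'rV['F_2]_d, subseq T S && (\sum_(x <- T) x == 0)%R].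
Proof.
have card_mask (b : bitseq) : size b = s ->
    size (mask b S) = #|[set i : 'I_s | nth false b i]|.
  move=> _; rewrite -sum1_size big_mask_tuple -sum1_card.
  by apply: eq_bigl => i; rewrite inE andbT.
apply: (iffP existsP) => [[T /andP[/subseqP[b sz_b T_b] /eqP T0]] | [B cardB B0]].
  exists [set i : 'I_s | nth false b i].
    by rewrite -card_mask ?sz_b ?size_tuple // -T_b size_tuple.
  rewrite -[RHS]T0 T_b big_mask_tuple; apply: eq_bigl => i.
  by rewrite inE andbT.
pose b := [seq i \in B | i <- enum 'I_s].
have nth_b (i : 'I_s) : nth false b i = (i \in B).
  by rewrite (nth_map i) ?size_enum_ord // nth_ord_enum.
have sz_b : size b = s by rewrite size_map size_enum_ord.
have sz_T : size (mask b S) == k.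
  by rewrite card_mask // -cardB; apply/eqP/eq_card => i; rewrite inE nth_b.
exists (Tuple sz_T); apply/andP; split; first exact: mask_subseq.
by rewrite big_mask_tuple -[X in _ == X]B0; apply/eqP/eq_bigl => i;
  rewrite nth_b andbT.
Qed.

Lemma has_zero_sum_subseq_leq k d s t :
  s <= t -> has_zero_sum_subseq k d s -> has_zero_sum_subseq k d t.
Proof.
move=> le_st /forallP has_s; apply/forallP => S.
have sz_S : size (take s S) == s by rewrite size_takel ?size_tuple.
have /existsP[T /andP[sub_T T0]] := has_s (Tuple sz_S).
apply/existsP; exists T; rewrite T0 andbT.
by apply: subseq_trans sub_T _; apply: take_subseq.
Qed.

Lemma F2_cases (c : 'F_2) : c = 0%R \/ c = 1%R.
Proof. by case: c => [[|[|//]] lt_c]; [left | right]; apply: val_inj. Qed.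

Lemma F2_addrr n p (A : 'M['F_2]_(n, p)) : (A + A = 0)%R.
Proof.
by apply/matrixP => i j; rewrite !mxE addrr_pchar2 // pchar_Fp.
Qed.

(** Coordinate [j] of a sum over [B] sees only the [j]-th unit vector and the all-one vector, so [B]
    contains all [d.+1] nonzero vectors, which exceeds [k], or only some of the [k.-1] zeros. *)
Lemma zero_sum_subseq_free k d s :
  0 < k <= d -> s <= k + d -> ~~ has_zero_sum_subseq k d s.
Proof.
case/andP=> k_gt0 le_kd le_s; apply: contraT; rewrite negbK.
move=> /(has_zero_sum_subseq_leq le_s) /forallP.
pose f (i : nat) : 'rV['F_2]_d :=
  (if (i < d)%N then \row_j (j == i :> nat)%:R
   else if i == d then const_mx 1 else 0)%R.
move=> /(_ [tuple f i | i < k + d])/zero_sum_subseqP[B cardB].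
under eq_bigr => i _ do rewrite tnth_mktuple.
move=> B0.
have lt_d (j : 'I_d) : j < k + d by rewrite (leq_trans (ltn_ord j)) ?leq_addl.
have dP : d < k + d by rewrite -[X in X < _]add0n ltn_add2r.
have B_d (j : 'I_d) : (Ordinal (lt_d j) \in B) = (Ordinal dP \in B).
  have /rowP/(_ j) := B0; rewrite summxE !mxE.
  rewrite big_mkcond (bigD1 (Ordinal (lt_d j))) //= (bigD1 (Ordinal dP)) /=;
    last first.
    by rewrite -val_eqE /= neq_ltn ltn_ord orbT.
  rewrite big1 => [|i /andP[i_j i_d]]; last first.
    case: ifP => // _; rewrite /f; case: ifP => [lt_id | _].
      by move: i_j; rewrite !mxE -val_eqE /= eq_sym => /negPf->.
    by rewrite -val_eqE /= in i_d; rewrite (negPf i_d) mxE.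
  rewrite /f /= ltn_ord ltnn eqxx !mxE eqxx addr0.
  by do 2!case: (_ \in B).
have [d_B | d_notB] := boolP (Ordinal dP \in B).
  suff: d.+1 <= #|B| by rewrite cardB ltnNge le_kd.
  have leB : d < k + d by [].
  have inj_w : injective (widen_ord leB) by move=> i j /(congr1 val)/= /val_inj.
  rewrite -[X in X <= _]card_ord -(card_imset _ inj_w) subset_leq_card //.
  apply/subsetP => _ /imsetP[i _ ->].
  have [lt_id | ge_id] := ltnP i d.
    rewrite (_ : widen_ord _ _ = Ordinal (lt_d (Ordinal lt_id))) ?B_d //.
    exact: val_inj.
  rewrite (_ : widen_ord _ _ = Ordinal dP) //; apply: val_inj => /=.
  by apply/eqP; rewrite eqn_leq ge_id -ltnS ltn_ord.
suff: #|B| <= k.-1 by rewrite cardB -ltnS prednK // ltnn.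
have lt_r (i : 'I_k.-1) : i + d.+1 < k + d.
  by have := ltn_ord i; rewrite -ltnS addnS -addSn ltn_add2r prednK.
have inj_r : injective (fun i => Ordinal (lt_r i)).
  by move=> i j /(congr1 val)/= /eqP; rewrite eqn_add2r => /eqP/val_inj.
rewrite -[X in _ <= X]card_ord -(card_imset _ inj_r) subset_leq_card //.
apply/subsetP => i i_B.
have lt_di : d < i.
  rewrite ltnNge; apply: contraNN d_notB; rewrite leq_eqVlt => /orP[/eqP i_d|lt_id].
    by rewrite (_ : Ordinal dP = i) //; apply: val_inj.
  rewrite -(B_d (Ordinal lt_id)).
  by rewrite (_ : Ordinal _ = i) //; apply: val_inj.
have lt_k : i - d.+1 < k.-1.
  have lt_i := ltn_ord i.
  by rewrite ltn_subLR // (leq_trans lt_i) // addSn -addnS prednK // addnC.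
by apply/imsetP; exists (Ordinal lt_k) => //; apply: val_inj; rewrite /= subnK.
Qed.

(** * Forbidden patterns in the coordinate matrix *)

Section SelectionMatrix.

Variables (r : nat) (x : 'I_r -> 'I_r -> bool).

(* Only the coordinates in [D :|: Z] matter: the other ones are corrected by the
   choice between [a_l] and [b_l]. The condition says that these coordinates of the
   sum of the [e_l], [l \in D], and the [a_l], [l \notin D :|: Z], vanish. *)
Definition selectable :=
  exists D Z : {set 'I_r}, [/\ [disjoint D & Z], #|Z| = #|D|.+1 &
    forall i, i \in D :|: Z ->
      odd (\sum_(l | l \notin D :|: Z) x i l) = (i \in D)].

Local Notation t i j k := (x i j (+) x i k).

Hypothesis no_sel : ~ selectable.

Lemma odd_row i : odd (\sum_(l | l != i) x i l).
Proof.
apply: contra_notT no_sel => /negPf row_i; exists set0, [set i]; split.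
- by rewrite -setI_eq0 set0I.
- by rewrite cards1 cards0.
move=> j; rewrite set0U inE => /eqP ->; rewrite in_set0 -row_i.
by congr odd; apply: eq_bigl => l; rewrite inE.
Qed.

Lemma odd_row_setC (s : seq 'I_r) i : uniq (i :: s) ->
  odd (\sum_(l | l \notin i :: s) x i l) = ~~ odd (\sum_(l <- s) x i l).
Proof.
move=> /= /andP[i_s uniq_s]; have := odd_row i.
rewrite (bigID (mem s)) /= oddD (eq_bigl (mem s)) => [|l]; last first.
  by rewrite andb_idl // => l_s; apply: contraNneq i_s => <-.
rewrite -big_uniq //= [X in _ -> odd X = _](eq_bigl (fun l =>
  (l != i) && (l \notin s))) => [|l].
  by case: (odd _); case: (odd _).
by rewrite inE negb_or.
Qed.

(** By [odd_row_setC], the parity of a row outside [i, j, k] is the negation of [t]; the hypotheses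
    thus make [D = [set i]], [Z = [set j; k]] a selection. *)
Lemma triple_rule i j k : uniq [:: i; j; k] ->
  t i j k = false -> t j i k = true -> t k i j = true -> False.
Proof.
move=> u3 ti tj tk; apply: no_sel; exists [set i], [set j; k].
have [ij ik jk] : [/\ i != j, i != k & j != k].
  by move: u3; rewrite /= !inE !negb_or => /and3P[/andP[-> ->] -> _].
have I_def l : (l \in [set i] :|: [set j; k]) = (l \in [:: i; j; k]).
  by rewrite !inE.
split.
- by rewrite disjoints1 !inE negb_or ij.
- by rewrite cards1 cards2 jk.
move=> l; rewrite I_def; under eq_bigl do rewrite I_def.
have perm_row a s : perm_eq [:: i; j; k] (a :: s) ->
   odd (\sum_(l | l \notin [:: i; j; k]) x a l) = ~~ odd (\sum_(l <- s) x a l).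
  move=> p; under eq_bigl do rewrite (perm_mem p).
  by rewrite odd_row_setC -?(perm_uniq p).
rewrite !inE => /or3P[]/eqP->.
- by rewrite (perm_row i [:: j; k]) // !big_cons big_nil addn0 oddD !oddb ti eqxx.
- rewrite (perm_row j [:: i; k]) ?(perm_catCA [:: i] [:: j]) //.
  by rewrite !big_cons big_nil addn0 oddD !oddb tj eq_sym (negPf ij).
rewrite (perm_row k [:: i; j]) ?(perm_catC [:: i; j] [:: k]) //.
by rewrite !big_cons big_nil addn0 oddD !oddb tk eq_sym (negPf ik).
Qed.

(** The same computation with [D = [set l; m]] and [Z = [set i; j; k]]. *)
Lemma quintuple_rule i j k l m : uniq [:: i; j; k; l; m] ->
  t i j k (+) t i l m = true -> t j i k (+) t j l m = true ->
  t k i j (+) t k l m = true ->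
  t l i j (+) t l k m = false -> t m i j (+) t m k l = false -> False.
Proof.
move=> u5 ti tj tk tl tm; apply: no_sel; exists [set l; m], [set i; j; k].
have I_def a : (a \in [set l; m] :|: [set i; j; k]) = (a \in [:: i; j; k; l; m]).
  by rewrite !inE; do 5!case: (a == _).
have u5' := u5; move: u5'; rewrite /= !inE !negb_or => /and5P[].
case/and4P=> ij ik il im /and3P[jk jl jm] /andP[kl km] lm _.
split.
- rewrite -setI_eq0; apply/eqP/setP => a; rewrite !inE.
  apply/negP => /andP[/orP[]/eqP-> /orP[/orP[]|] /eqP e]; move: u5 => /=;
  by rewrite e !inE !eqxx ?orbT ?andbF.
- have /card_uniqP /= card3 : uniq [:: i; j; k] by rewrite /= !inE negb_or ij ik jk.
  by rewrite cards2 lm -[RHS]card3; apply: eq_card => a; rewrite !inE orbA.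
move=> a; rewrite I_def; under eq_bigl do rewrite I_def.
have perm_row b s : perm_eq [:: i; j; k; l; m] (b :: s) ->
   odd (\sum_(c | c \notin [:: i; j; k; l;
     m]) x b c) = ~~ odd (\sum_(c <- s) x b c).
  move=> p; under eq_bigl do rewrite (perm_mem p).
  by rewrite odd_row_setC -?(perm_uniq p).
have E b c1 c2 c3 c4 : odd (\sum_(c <- [:: c1; c2; c3; c4]) x b c) =
    t b c1 c2 (+) t b c3 c4.
  by rewrite !big_cons big_nil addn0 !oddD !oddb !addbA.
rewrite in_cons in_cons in_cons in_cons mem_seq1 !inE.
case/or4P=> [/eqP->|/eqP->|/eqP->|].
- by rewrite (perm_row i [:: j; k; l; m]) // E ti (negPf il) (negPf im).
- rewrite (perm_row j [:: i; k; l; m]) ?E ?tj ?(negPf jl) ?(negPf jm) //.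
  by rewrite (perm_catCA [:: i] [:: j]).
- rewrite (perm_row k [:: i; j; l; m]) ?E ?tk ?(negPf kl) ?(negPf km) //.
  by rewrite (perm_catCA [:: i; j] [:: k]).
case/orP=> /eqP->.
  rewrite (perm_row l [:: i; j; k; m]) ?E ?tl ?eqxx //.
  by rewrite (perm_catCA [:: i; j; k] [:: l]).
rewrite (perm_row m [:: i; j; k; l]) ?E ?tm ?eqxx ?orbT //.
by rewrite (perm_catC [:: i; j; k; l] [:: m]).
Qed.

Definition side i b := [set l | (l != i) && (x i l == b)].

Hypothesis odd_r : odd r.

(** The [true] side is odd by [odd_row], and both sides together have the even size [r.-1], so both
    are odd. *)
Lemma side_neq0 i b : exists l, l \in side i b.
Proof.
apply/set0Pn; rewrite -card_gt0; suff: odd #|side i b| by case: #|_|.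
have cardT : odd #|side i true|.
  rewrite (_ : #|_| = \sum_(l | l != i) x i l) ?odd_row //.
  rewrite -sum1_card big_mkcond [RHS]big_mkcond; apply: eq_bigr => l _.
  by rewrite inE; case: (l != i) (x i l) => [] [].
have := cardsC1 i; rewrite card_ord -(cardsID [set l | x i l]) => /(congr1 odd).
rewrite oddD (eqP (_ : [set~ i] :&: _ == side i true)); last first.
  by apply/eqP/setP=> l; rewrite !inE; case: (x i l).
rewrite (eqP (_ : [set~ i] :\: _ == side i false)); last first.
  by apply/eqP/setP=> l; rewrite !inE andbC; case: (x i l).
have -> : odd r.-1 = false by case: (r) odd_r => //= n /negbTE.
by rewrite cardT; case: b => //; case: (odd _).
Qed.

(* A vertex [j] of a smallest side is separated from some vertex of the other
   side together with [i]: otherwise one side of [j] would be smaller still. *)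
Lemma cyclic_triple_exists :
  exists i j k, [/\ uniq [:: i; j; k], t i j k, t j i k & t k i j].
Proof.
have r_gt0 : 0 < r by case: r odd_r.
case: (@arg_minnP _ (Ordinal r_gt0, true) predT (fun p => #|side p.1 p.2|) isT).
case=> i b _ /= min_ib; have [j j_ib] := side_neq0 i b.
have /andP[j_i /eqP x_ij] : (j != i) && (x i j == b) by rewrite inE in j_ib.
have [k k_i k_j] : exists2 k, k \in side i (~~ b) & t j i k.
  apply/exists_inP; apply: contraT; rewrite negb_exists_in => /forall_inP same_j.
  (* The side of [j] without [i]: by [same_j] it misses the other side of [i], so it lies in
     [side i b], and it omits [j]. *)
  have := min_ib (j, ~~ x j i) isT; rewrite leqNgt /= => /negP[].
  apply/proper_card/properP; split; last first.
    by exists j => //; rewrite !inE eqxx.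
  apply/subsetP=> l; rewrite !inE => /andP[l_j /eqP x_jl].
  have l_i : l != i by apply: contraPneq x_jl => ->; case: (x j i).
  rewrite l_i /=; apply: contraT => neq_b.
  have /same_j : l \in side i (~~ b).
    by rewrite inE l_i /=; case: (x i l) (b) neq_b => [] [].
  by rewrite x_jl; case: (x j i).
move: k_i; rewrite inE => /andP[k_i /eqP x_ik].
have t_i : t i j k by rewrite x_ij x_ik; case: (b).
have u3 : uniq [:: i; j; k].
  rewrite /= !inE !negb_or !andbT eq_sym j_i eq_sym k_i /=.
  by apply: contraPneq x_ik => <-; rewrite x_ij; case: (b).
exists i, j, k; split=> //; case t_k: (t k i j) => //; exfalso.
apply: (@triple_rule k i j) => //.
- by rewrite (perm_uniq (permEl (perm_catC [:: k] [:: i; j]))).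
- by rewrite addbC.
- by rewrite addbC.
Qed.

(** * Parity of the symmetric part on triples *)

Lemma triple_sum_neq2 i j k : uniq [:: i; j; k] -> t i j k + t j i k + t k i j != 2.
Proof.
move=> u3; have u3j : uniq [:: j; i; k].
  by rewrite (perm_uniq (permEl (perm_catCA [:: j] [:: i] [:: k]))).
have u3k : uniq [:: k; i; j].
  by rewrite (perm_uniq (permEl (perm_catC [:: k] [:: i; j]))).
have := triple_rule u3; have := triple_rule u3j; have := triple_rule u3k.
rewrite [t i k j]addbC [t j k i]addbC [t k j i]addbC.
case: (t i j k) (t j i k) (t k i j) => [] [] [] // rule_k rule_j rule_i.
- by case: rule_k.
- by case: rule_j.
- by case: rule_i.
Qed.

Local Notation s i j := (x i j (+) x j i).
(** The coboundary of the symmetric [s]: it is 1 on all triples of distinct indices exactly when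
    [s i j = 1 + u_i + u_j] for some [u]. *)
Local Notation g i j k := (s i j (+) s i k (+) s j k).

Lemma triple_sumE i j k : t i j k (+) t j i k (+) t k i j = g i j k.
Proof.
by case: (x i j) (x i k) (x j i) (x j k) (x k i) (x k j) => [] [] [] [] [] [].
Qed.

Lemma even_triple i j k : uniq [:: i; j; k] -> g i j k = false ->
  [/\ t i j k = false, t j i k = false & t k i j = false].
Proof.
move=> /triple_sum_neq2; rewrite -triple_sumE.
by case: (t i j k) (t j i k) (t k i j) => [] [] [].
Qed.

(** If [g i j l] is false, all [t] on [i, j, l] vanish. Then [t i k l] and [t j k l] hold,
    [t l i k = t l j k], and [t k i l], [t k j l] differ, so [i, k, l] or [j, k, l] has sum 2. *)
Lemma cyclic_triple_odd i j k l : uniq [:: i; j; k; l] ->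
  t i j k -> t j i k -> t k i j -> [/\ g i j l, g i k l & g j k l].
Proof.
move=> u4 ti tj tk.
have := @triple_sum_neq2 i j l (mask_uniq u4 [:: true; true; false; true]).
have := @triple_sum_neq2 i k l (mask_uniq u4 [:: true; false; true; true]).
have := @triple_sum_neq2 j k l (mask_uniq u4 [:: false; true; true; true]).
rewrite -!triple_sumE.
have {ti}-> : x i k = ~~ x i j by case: (x i j) (x i k) ti => [] [].
have {tj}-> : x j k = ~~ x j i by case: (x j i) (x j k) tj => [] [].
have {tk}-> : x k j = ~~ x k i by case: (x k i) (x k j) tk => [] [].
by case: (x i j) (x i l) (x j i) (x j l) (x k i) (x k l) (x l i) (x l j) (x l k)
  => [] [] [] [] [] [] [] [] [].
Qed.

(** As [g] sums to 0 over the triples of a quadruple, [g i l m] false makes [g j l m] and [g k l m]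
    false. All [t] on these three triples vanish, and [quintuple_rule] applies. *)
Lemma cyclic_quintuple_odd i j k l m : uniq [:: i; j; k; l; m] ->
  t i j k -> t j i k -> t k i j -> g i l m.
Proof.
move=> u5 ti tj tk; apply: contraT => /negbTE g_i.
have [g_ijl g_ikl g_jkl] := @cyclic_triple_odd i j k l
  (mask_uniq u5 [:: true; true; true; true; false]) ti tj tk.
have [g_ijm g_ikm g_jkm] := @cyclic_triple_odd i j k m
  (mask_uniq u5 [:: true; true; true; false; true]) ti tj tk.
have g_j : g j l m = false.
  move: g_i g_ijl g_ijm.
  by case: (s i j) (s i l) (s i m) (s j l) (s j m) (s l m) => [] [] [] [] [] [].
have g_k : g k l m = false.
  move: g_i g_ikl g_ikm.
  by case: (s i k) (s i l) (s i m) (s k l) (s k m) (s l m) => [] [] [] [] [] [].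
have [ti' tl_i tm_i] := @even_triple i l m
  (mask_uniq u5 [:: true; false; false; true; true]) g_i.
have [tj' tl_j tm_j] := @even_triple j l m
  (mask_uniq u5 [:: false; true; false; true; true]) g_j.
have [tk' tl_k tm_k] := @even_triple k l m
  (mask_uniq u5 [:: false; false; true; true; true]) g_k.
have t_split a b c d : t a b c = t a b d (+) t a c d.
  by case: (x a b) (x a c) (x a d) => [] [] [].
exfalso; apply: (quintuple_rule u5); rewrite ?ti ?tj ?tk ?ti' ?tj' ?tk' //.
  by rewrite (t_split l i j m) tl_i tl_j tl_k.
by rewrite (t_split m i j l) tm_i tm_j tm_k.
Qed.

Lemma center_triple_odd : exists i, forall l m, uniq [:: i; l; m] -> g i l m.
Proof.
have [i [j [k [u3 ti tj tk]]]] := cyclic_triple_exists.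
have g_ijk : g i j k by rewrite -triple_sumE ti tj tk.
have gC l m : g i l m = g i m l.
  by rewrite [s m l]addbC [s i m (+) s i l]addbC.
have [ij ik jk] : [/\ i != j, i != k & j != k].
  by move: u3; rewrite /= !inE negb_or !andbT => /andP[/andP[]].
exists i => l m /=; rewrite !inE negb_or !andbT => /andP[/andP[il im] lm].
have odd_j l' : i != l' -> l' != j -> g i j l'.
  move=> il' l'j; have [->//|l'k] := eqVneq l' k.
  have [] // := @cyclic_triple_odd i j k l' _ ti tj tk.
  by rewrite /= !inE !negb_or ij ik il' jk eq_sym l'j eq_sym l'k.
have odd_k l' : i != l' -> l' != k -> g i k l'.
  move=> il' l'k; have [->|l'j] := eqVneq l' j; first by rewrite gC.
  have [] // := @cyclic_triple_odd i j k l' _ ti tj tk.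
  by rewrite /= !inE !negb_or ij ik il' jk eq_sym l'j eq_sym l'k.
have [l_j | lj] := eqVneq l j; first by rewrite l_j odd_j // eq_sym -l_j.
have [-> | mj] := eqVneq m j; first by rewrite gC odd_j.
have [l_k | lk] := eqVneq l k; first by rewrite l_k odd_k // eq_sym -l_k.
have [-> | mk] := eqVneq m k; first by rewrite gC odd_k.
apply: (@cyclic_quintuple_odd i j k l m) => //=.
by rewrite !inE !negb_or ij ik il im jk lm eq_sym lj eq_sym mj eq_sym lk eq_sym mk.
Qed.

(** * Counting arcs of a tournament *)

Lemma tournament_odd_outdegree (y : 'I_r -> 'I_r -> bool) :
    (forall a b, a != b -> y a b (+) y b a) ->
    (forall a, odd (\sum_(b | b != a) y a b)) ->
  odd r.-1./2.
Proof.
move=> y_tour y_row.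
(* Each pair carries one arc, so twice the number of arcs is [r * r.-1]; that number is odd, being a
   sum of [r] odd outdegrees. *)
have : \sum_a \sum_(b | b != a) y a b + \sum_a \sum_(b | b != a) y a b = r * r.-1.
  rewrite {2}(exchange_big_dep predT) //= -big_split /= -[in X in X * _](card_ord r).
  rewrite -sum_nat_const; apply: eq_bigr => a _.
  under [X in _ + X]eq_bigl => b do rewrite eq_sym.
  rewrite -big_split /= -[in RHS](card_ord r) -(cardC1 a) -sum1_card.
  by apply: eq_bigr => b /y_tour; case: (y b a) (y a b) => [] [].
set N := \sum_a _; have odd_N : odd N.
  suff -> : odd N = odd (\sum_(a < r) 1) by rewrite sum1_card card_ord odd_r.
  rewrite /N !(big_morph odd oddD (erefl _)).
  by apply: eq_bigr => a _; rewrite y_row.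
have def_r : r.-1 = r.-1./2.*2.
  by rewrite even_halfK //; case: (r) odd_r.
move=> sum_y; have /double_inj N_def : N.*2 = (r * r.-1./2).*2.
  by rewrite -addnn sum_y {1}def_r doubleMr.
by move: odd_N; rewrite N_def oddM => /andP[].
Qed.

Lemma odd_half_pred : odd r.-1./2.
Proof.
have [i g_i] := center_triple_odd.
(* [g i a b] gives [s a b = 1 + s i a + s i b]; the same formula at [a = i] forces [u i] to be
   true. *)
pose u a := (a == i) || s i a.
have s_u a b : a != b -> s a b = ~~ (u a (+) u b).
  rewrite /u; have [-> | ai] := eqVneq a i; have [-> | bi] := eqVneq b i => ab /=.
  - by [].
  - by case: (s i b).
  - by case: (x i a) (x a i) => [] [].
  have := g_i a b; rewrite /= !inE negb_or ab eq_sym ai eq_sym bi => /(_ isT).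
  by case: (s i a) (s i b) (s a b) => [] [] [].
apply: (@tournament_odd_outdegree (fun a b => x a b (+) u a)) => [a b ab | a].
  have := s_u a b ab.
  by case: (x a b) (x b a) (u a) (u b) => [] [] [] [].
(* Flipping the [r.-1] off-diagonal entries of a row keeps its parity. *)
case: (u a); last by under eq_bigr => b _ do rewrite addbF; rewrite odd_row.
have := odd_row a; have : \sum_(b | b != a) (x a b (+) true) +
  \sum_(b | b != a) x a b = r.-1.
  rewrite -big_split /= -[in RHS](card_ord r) -(cardC1 a) -sum1_card.
  by apply: eq_bigr => b _; case: (x a b).
have : odd r.-1 = false by case: (r) odd_r => //= n /negbTE.
by move=> even_r sum_r odd_a; move: even_r;
  rewrite -sum_r oddD odd_a addbT => /negbFE.
Qed.

End SelectionMatrix.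

(** * Selections from paired vectors *)

Section PairedVectors.

Local Open Scope ring_scope.

Variable r : nat.
Implicit Type p : 'I_r * bool -> 'rV['F_2]_r.

Definition has_zero_choice p : bool :=
  [exists Q : {set 'I_r * bool}, (#|Q| == r.-1) && (\sum_(q in Q) p q == 0)].

Definition fst_mx p : 'M['F_2]_r := \matrix_l p (l, false).
Definition diff_mx p : 'M['F_2]_r := \matrix_l (p (l, false) + p (l, true)).

Lemma F2_natr_odd n : n%:R = (odd n)%:R :> 'F_2.
Proof.
by rewrite -[in LHS](odd_double_half n) natrD -muln2 natrM
  (pchar_Fp_0 (isT : prime 2)) mulr0 addr0.
Qed.

Lemma F2_mx1_cases (u : 'M['F_2]_1) : u = 0 \/ u = 1.
Proof.
rewrite (mx11_scalar u); have [-> | ->] := F2_cases (u 0 0); last by right.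
by left; rewrite raddf0.
Qed.

(** [c l] decides between [a_l] and [b_l = a_l + e_l]; the size is
    [2|D| + (r - |D| - |Z|) = r - 1]. *)
Lemma zero_choice_of p (D Z : {set 'I_r}) (c : 'I_r -> 'F_2) :
  [disjoint D & Z] -> #|Z| = #|D|.+1 ->
  \sum_(l in D) row l (diff_mx p)
    + \sum_(l | l \notin D :|: Z)
        (row l (fst_mx p) + c l *: row l (diff_mx p)) = 0 ->
  has_zero_choice p.
Proof.
move=> DZ cardZ sum0.
pose Q := [set q : 'I_r * bool | (q.1 \in D)
  || (q.1 \notin D :|: Z) && (q.2 == (c q.1 != 0))].
have sumQ (R : nmodType) (F : 'I_r * bool -> R) : \sum_(q in Q) F q =
    \sum_(l in D) (F (l, false) + F (l, true)) +
    \sum_(l | l \notin D :|: Z) F (l, c l != 0).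
  rewrite big_mkcond (eq_bigr (fun q =>
    if (q.1, q.2) \in Q then F (q.1, q.2) else 0)).
    rewrite -(pair_bigA _ (fun l b => if (l, b) \in Q then F (l, b) else 0)) /=.
    rewrite [X in _ = X + _]big_mkcond [X in _ = _ + X]big_mkcond -big_split.
    apply: eq_bigr => l _; rewrite big_bool !inE /=.
    case: (l \in D) => /=; first by rewrite addr0 addrC.
    by case: (l \in Z); case: (c l != 0); rewrite /= ?addr0 ?add0r.
  by case.
apply/existsP; exists Q; apply/andP; split; apply/eqP.
  have := sumQ _ (fun=> 1%N); rewrite sum1_card => ->.
  have := cardsC (D :|: Z);
    rewrite card_ord cardsU (disjoint_setI0 DZ) cards0 subn0 cardZ.
  rewrite addnS addSn => /(congr1 predn) /= <-.
  rewrite [X in (X + _)%R]sum_nat_const muln2 -addnn; congr addn.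
  by rewrite sum1_card -cardsE; apply: eq_card => l; rewrite !inE.
rewrite sumQ -[RHS]sum0; congr (_ + _); apply: eq_bigr => l _; rewrite !rowK //.
have [-> | ->] := F2_cases (c l); first by rewrite eqxx scale0r addr0.
by rewrite scale1r addrA F2_addrr add0r.
Qed.

Lemma unit_diff_zero_choice p : odd r -> ~~ odd r.-1./2 ->
  diff_mx p \in unitmx -> has_zero_choice p.
Proof.
move=> odd_r even_m unitE; apply: contraT => no_choice.
(* Row [l] of [X] holds the coordinates of [a_l] in the basis of the [e_i]; [x] is transposed. *)
pose X := fst_mx p *m invmx (diff_mx p); pose x i l := X l i != 0.
have F2_neq0 (c : 'F_2) : c = (c != 0 : nat)%:R by have [-> | ->] := F2_cases c.
case/negP: even_m; apply: (@odd_half_pred _ x) => // -[D [Z [DZ cardZ sel]]].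
case/negP: no_choice.
(* [w] is the uncorrected selection and [y] its coordinates. They vanish on [D :|: Z] by [sel], so
   adding [e_l] wherever [y 0 l] is 1 cancels [w]. *)
pose w := \sum_(l in D) row l (diff_mx p) +
  \sum_(l | l \notin D :|: Z) row l (fst_mx p).
pose y := w *m invmx (diff_mx p).
have y0 i : i \in D :|: Z -> y 0 i = 0.
  move=> /[dup] iDZ /sel sel_i.
  rewrite /y mulmxDl !mulmx_suml mxE !summxE.
  rewrite (eq_bigr (fun l => (l == i)%:R)) => [|l _]; last first.
    by rewrite -row_mul mulmxV // !mxE.
  rewrite [X in _ + X](eq_bigr (fun l => (x i l : nat)%:R)) => [|l _]; last first.
    by rewrite -row_mul mxE [LHS]F2_neq0.
  rewrite -!natr_sum -natrD F2_natr_odd oddD sel_i.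
  suff -> : (\sum_(l in D) (l == i) = (i \in D))%N by case: (i \in D).
  rewrite big_mkcond (bigD1 i) //= eqxx big1 ?addn0; first by case: (i \in D).
  by move=> l /negPf ->; case: ifP.
apply: (@zero_choice_of _ D Z (fun l => y 0 l)) => //.
rewrite big_split /= addrA -/w (_ : \sum_(l | _) _ = w) ?F2_addrr //.
rewrite -[RHS](mulmxKV unitE) -/y mulmx_sum_row [RHS](bigID (mem (D :|: Z))) /=.
by rewrite [X in _ = X + _]big1 ?add0r // => l /y0 ->; rewrite scale0r.
Qed.

(** * Dependent differences: separating functionals and exchanges *)

Lemma choice_separator p q : ~~ has_zero_choice p -> exists v : 'cV_r,
  (forall l, l != q -> row l (diff_mx p) *m v = 0) /\
  (\sum_(l | l != q) row l (fst_mx p)) *m v = 1.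
Proof.
move=> no_choice.
(* Take [D] empty and [Z = [set q]]: without a zero choice, [w] is outside the span of the [e_l],
   [l != q], and a column of the cokernel separates it. *)
pose Eq : 'M_r := \matrix_l (if l == q then 0 else row l (diff_mx p)).
set w := \sum_(l | _) _.
have /matrix0Pn : w *m cokermx Eq != 0.
  rewrite -submxE; apply: contraNN no_choice => /submxP[y w_y].
  apply: (@zero_choice_of _ set0 [set q] (fun l => y 0 l)).
  - by rewrite -setI_eq0 set0I.
  - by rewrite cards1 cards0.
  rewrite big_set0 add0r set0U.
  under eq_bigl do rewrite inE.
  rewrite big_split /= -/w {1}w_y mulmx_sum_row [X in X + _](bigD1 q) //=.
  rewrite rowK eqxx scaler0 add0r.
  rewrite (eq_bigr (fun l => y 0 l *: row l (diff_mx p))) ?F2_addrr // =>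
    l /negPf lq.
  by rewrite rowK lq.
case=> i [j]; rewrite ord1 => w_j.
exists (col j (cokermx Eq)); split=> [l lq|].
  have -> : row l (diff_mx p) = row l Eq by rewrite [RHS]rowK (negPf lq).
  by rewrite colE mulmxA -row_mul mulmx_coker linear0 mul0mx.
rewrite colE mulmxA -colE; apply/matrixP=> a b; rewrite !ord1 mxE [RHS]mxE eqxx.
by have [w_0 | //] := F2_cases ((w *m cokermx Eq) 0 j); rewrite w_0 eqxx in w_j.
Qed.

Definition swap_pairs (k l : 'I_r) p := p \o tperm (k, true) (l, false).

(** Exchanging [b_k] with [a_l] adds [b_k + a_l] to both [e_k] and [e_l]. *)
Lemma diff_mx_swap p k l : k != l ->
  diff_mx (swap_pairs k l p) = diff_mx p +
    (delta_mx k 0 + delta_mx l 0) *m (p (k, true) + p (l, false)).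
Proof.
move=> kl; apply/row_matrixP=> j;
  rewrite rowK linearD /= rowK row_mul [X in X *m _]linearD /=.
have row_delta i : row j (delta_mx i 0 : 'cV['F_2]_r) = (j == i)%:R%:M.
  by apply/matrixP=> a b; rewrite !ord1 !mxE eqxx andbT.
rewrite !row_delta mulmxDl !mul_scalar_mx /swap_pairs /=.
rewrite !permE /= !xpair_eqE !(andbT, andbF) /=.
have [-> | jk] := eqVneq j k.
  rewrite (negPf kl) scale1r scale0r addr0.
  by rewrite addrA -[X in _ = X + _]addrA F2_addrr addr0.
have [-> | jl] := eqVneq j l.
  by rewrite scale0r scale1r add0r [X in _ = _ + X]addrC addrACA
     F2_addrr add0r addrC.
by rewrite !scale0r !addr0.
Qed.

(* Otherwise the exchange of vectors between the pairs [k] and [l] would shrink the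
   left kernel, that is, raise the rank. *)
Lemma diff_mx_ker_const p k l (v : 'cV_r) (y : 'rV_r) :
    (\rank (diff_mx (swap_pairs k l p)) <= \rank (diff_mx p))%N ->
    diff_mx p *m v = 0 -> row k (fst_mx p) *m v != row l (fst_mx p) *m v ->
  y *m diff_mx p = 0 -> y 0 k = y 0 l.
Proof.
move=> le_rank Ev neq_v yE; apply: contraTeq le_rank => neq_y.
have kl : k != l by apply: contraNneq neq_v => ->.
rewrite -ltnNge; set E' := diff_mx (swap_pairs k l p).
have ker_E' (z : 'rV_r) : z *m E' = 0 -> z 0 k = z 0 l /\ z *m diff_mx p = 0.
  rewrite /E' diff_mx_swap // mulmxDr mulmxA mulmxDr -!colE.
  set d := p (k, true) + p (l, false); set c := col k z + col l z => zE'.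
  have cE : c = (z 0 k + z 0 l)%:M by apply/matrixP=> a b; rewrite !ord1 !mxE eqxx.
  (* [v] kills [e_k], so it agrees on [a_k] and [b_k] and separates [b_k] from [a_l]. Applied to
     [zE'], it then forces [z 0 k = z 0 l]. *)
  have dv : d *m v != 0.
    have /(congr1 (row k)) := Ev; rewrite row_mul rowK row0 mulmxDl => kv.
    move: neq_v; rewrite /d mulmxDl !rowK; apply: contra_neq => dv.
    by apply: (addIr (p (k, true) *m v)); rewrite kv addrC dv.
  have zkl : z 0 k + z 0 l = 0.
    have /(congr1 (mulmx^~ v)) := zE'.
    rewrite mulmxDl mul0mx -mulmxA Ev mulmx0 add0r -mulmxA cE mul_scalar_mx.
    by move/eqP; rewrite scaler_eq0 (negPf dv) orbF => /eqP.
  rewrite cE zkl raddf0 mul0mx addr0 in zE'; split=> //.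
  have [zl | zl] := F2_cases (z 0 l); first by rewrite zl addr0 in zkl;
    rewrite zl zkl.
  by apply: (addIr (z 0 l)); rewrite zkl zl; apply: val_inj.
have lt_ker : (kermx E' < kermx (diff_mx p))%MS.
  rewrite ltmxE; apply/andP; split.
    by apply/rV_subP=> z /sub_kermxP/ker_E'[_ zE]; apply/sub_kermxP.
  apply: contra neq_y => sub_ker.
  have /sub_kermxP/ker_E'[-> //] : (y <= kermx E')%MS.
  by apply: submx_trans sub_ker; apply/sub_kermxP.
by have := rank_ltmx lt_ker; rewrite !mxrank_ker ltn_sub2lE ?rank_leq_row.
Qed.

Lemma singular_diff_zero_choice p : odd r ->
    (forall k l, \rank (diff_mx (swap_pairs k l p)) <= \rank (diff_mx p))%N ->
    diff_mx p \notin unitmx -> has_zero_choice p.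
Proof.
move=> odd_r max_rank singE; apply: contraT => no_choice.
have [v vE] := fin_all_exists (fun q => choice_separator q no_choice).
pose E := diff_mx p; pose A := fst_mx p.
(* Otherwise the [v q] would be the columns of an inverse of [E]. *)
have [q0 Eq0] : exists q, row q E *m v q = 0.
  suff /existsP[q /eqP Eq] : [exists q, row q E *m v q == 0] by exists q.
  apply: contraNT singE; rewrite negb_exists => /forallP Eq.
  have /mulmx1_unit[] // : E *m (\matrix_(i, j) v j i 0) = 1%:M.
  apply/row_matrixP=> i; apply/rowP=> j.
  transitivity ((row i E *m v j) 0 0).
    by rewrite -row_mul !mxE; apply: eq_bigr => l _; rewrite !mxE.
  rewrite [RHS]mxE [RHS]mxE; have [<- | ij] := eqVneq i j;
    last by rewrite (vE j).1 ?mxE.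
  apply/eqP; apply: contraNT (Eq i) => ne1; apply/eqP/matrixP=> a b;
    rewrite !ord1 [RHS]mxE.
  by have [// | e1] := F2_cases ((row i E *m v i) 0 0); rewrite e1 eqxx in ne1.
have Ev0 : E *m v q0 = 0.
  apply/row_matrixP=> i; rewrite row_mul row0.
  by have [-> // | iq] := eqVneq i q0; rewrite (vE q0).1.
pose h l := row l A *m v q0.
have sum_h q : \sum_(l | l != q) h l = \sum_l h l - h q.
  by rewrite [in RHS](bigD1 q) //= addrC addrK.
have h1 : \sum_(l | l != q0) h l = 1 by rewrite -[RHS](vE q0).2 mulmx_suml.
(* A constant [h] would sum to 0 over the [r.-1] indices [l != q0], an even number. *)
have [q1 h_q1] : exists q1, h q1 != h q0.
  apply/existsP; apply: contraT; rewrite negb_exists => /forallP const_h.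
  move: h1; rewrite (eq_bigr (fun=> h q0)) => [|l _]; last by apply/eqP;
    rewrite -[_ == _]negbK.
  rewrite sumr_const cardC1 card_ord.
  have -> : h q0 *+ r.-1 = 0.
    have -> : r.-1 = r.-1./2.*2 by rewrite even_halfK //; case: (r) odd_r.
    by rewrite -addnn mulrnDr F2_addrr.
  by move/matrixP/(_ 0 0); rewrite !mxE.
have even_h : \sum_(l | l != q1) h l = 0.
  move: h1; rewrite !sum_h => h1; rewrite -subr_eq0 in h_q1.
  have [h10 | h10] := F2_mx1_cases (h q1 - h q0); first by rewrite h10 eqxx in h_q1.
  by rewrite -(subrKA (h q0)) h1 -opprB h10 subrr.
(* Exchanges equate [y] at indices with different [h]; both values of [h] occur, so [y] is
   constant. *)
have ker_const (y : 'rV_r) : y *m E = 0 -> y = y 0 q0 *: const_mx 1.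
  move=> yE; have y_h k l := @diff_mx_ker_const p k l (v q0) y (max_rank k l) Ev0.
  apply/rowP=> l; rewrite !mxE mulr1; have [h_l | /y_h->//] := eqVneq (h l) (h q0).
  by rewrite (y_h l q1) ?(y_h q1 q0) // -/(h l) h_l eq_sym.
(* The rows of [E] sum to 0, so [v q1], which kills all rows but [q1], kills that one too. *)
have Ev1 : E *m v q1 = 0.
  have /matrix0Pn[i [j ker_ij]] : kermx E != 0 by rewrite kermx_eq0 row_free_unit.
  pose y := row i (kermx E);
    have yE : y *m E = 0 by rewrite -row_mul mulmx_ker row0.
  have y_q0 : y 0 q0 = 1.
    have [y0 | //] := F2_cases (y 0 q0).
    have y_0 : y = 0 by rewrite (ker_const y yE) y0 scale0r.
    have /rowP/(_ j) := y_0; rewrite [LHS]mxE [RHS]mxE => ker0.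
    by rewrite ker0 eqxx in ker_ij.
  have y1 l : y 0 l = 1 by rewrite (ker_const y yE) y_q0 scale1r mxE.
  apply/row_matrixP=> l; rewrite row_mul row0.
  have [-> | lq] := eqVneq l q1; last by rewrite (vE q1).1.
  have := congr1 (mulmx^~ (v q1)) yE;
    rewrite mul0mx [y *m E]mulmx_sum_row mulmx_suml (bigD1 q1) //=.
  rewrite y1 scale1r big1 ?addr0 // => l' l'q.
  by rewrite -scalemxAl (vE q1).1 ?scaler0.
have sub_ker q : E *m v q = 0 -> ((v q)^T <= kermx E^T)%MS.
  by move=> Evq; apply/sub_kermxP; rewrite -trmx_mul Evq trmx0.
have v_nz : (v q0)^T != 0.
  rewrite trmx_eq0; apply/eqP=> v0; have := (vE q0).2.
  by rewrite v0 mulmx0 => /matrixP/(_ 0 0); rewrite !mxE.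
have rank_ker : (\rank (kermx E^T) <= 1)%N.
  rewrite mxrank_ker mxrank_tr -mxrank_ker.
  have : (kermx E <= (const_mx 1 : 'rV_r))%MS.
    by apply/rV_subP=> y /sub_kermxP/ker_const->; rewrite scalemx_sub.
  by move/mxrankS/leq_trans; apply; apply: rank_leq_row.
have ker_sub : (kermx E^T <= (v q0)^T)%MS.
  by rewrite -(geq_leqif (mxrank_leqif_sup (sub_ker q0 Ev0))) rank_rV v_nz.
(* [v q1] is a multiple of [v q0], but on the sum of the [a_l], [l != q1], they take the values 1
   and 0. *)
have /sub_rVP[c] := submx_trans (sub_ker q1 Ev1) ker_sub.
rewrite -linearZ => /trmx_inj v_q1; have := (vE q1).2.
rewrite v_q1 -scalemxAr mulmx_suml even_h scaler0.
by move/matrixP/(_ 0 0); rewrite !mxE.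
Qed.

End PairedVectors.

(** * Rank-maximal pairing and conclusion *)

Lemma has_zero_sum_subseq_even m : ~~ odd m ->
  has_zero_sum_subseq (2 * m) (2 * m + 1) (4 * m + 2).
Proof.
move=> even_m; apply/forallP=> S; set r := 2 * m + 1.
have odd_r : odd r by rewrite oddD oddM.
have half_r : r.-1./2 = m by rewrite /r addn1 mul2n doubleK.
have card_pairs : #|{: 'I_r * bool}| = 4 * m + 2.
  by rewrite card_prod card_ord card_bool mulnDl mulnAC.
pose f0 := [ffun q : 'I_r * bool => cast_ord card_pairs (enum_rank q)].
have inj_f0 : injectiveb f0.
  by apply/injectiveP=> a b; rewrite !ffunE => /cast_ord_inj/enum_rank_inj.
pose p (f : {ffun 'I_r * bool -> 'I_(4 * m + 2)}) := tnth S \o f.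
case: (@arg_maxnP _ f0 (fun f => injectiveb f)
  (fun f => \rank (diff_mx (p f))) inj_f0).
move=> f /injectiveP inj_f max_f.
have max_rank k l : \rank (diff_mx (swap_pairs k l (p f))) <= \rank (diff_mx (p f)).
  pose f' := [ffun q => f (tperm (k, true) (l, false) q)].
  rewrite (_ : diff_mx (swap_pairs k l (p f)) = diff_mx (p f')).
    by apply: max_f; apply/injectiveP=> a b; rewrite !ffunE => /inj_f/perm_inj.
  by apply/matrixP=> i j; rewrite !mxE /swap_pairs /p /= !ffunE.
have /existsP[Q /andP[/eqP cardQ /eqP Q0]] : has_zero_choice (p f).
  have [unitE | singE] := boolP (diff_mx (p f) \in unitmx).
    by apply: unit_diff_zero_choice; rewrite ?half_r.
  exact: singular_diff_zero_choice.
apply/zero_sum_subseqP; exists (f @: Q);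
  first by rewrite card_imset // cardQ /r addn1.
by rewrite big_imset //= => a b _ _; apply: inj_f.
Qed.

Theorem theorem14 (m : nat) (m_gt0 : 0 < m) (m_even : ~~ odd m) :
  s_even m (2 * m + 1) = 4 * m + 2.
Proof.
rewrite /s_even; case: ex_minnP => s has_s min_s; apply/eqP; rewrite eqn_leq.
rewrite min_s ?has_zero_sum_subseq_even //= leqNgt; apply: contraL has_s => lt_s.
apply: zero_sum_subseq_free; first by rewrite muln_gt0 m_gt0 leq_addr.
by rewrite addnA -mulnDl -ltnS -addnS.
Qed.
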